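(* Let $V<C<M$ be real numbers, let $0\le p_1\le p_2\le p_3\le p_4\le 1$, $\tilde p=(p_1,p_2,p_3,p_4)$, and let $\beta\in[0,1]$. For $Q\in\mathbb{R}$ and $\alpha\in[0,1]$ let $Y^1_\alpha,Y^2_\alpha$ be the lower and upper endpoints of the $\alpha$-cut of the fuzzy profit with order quantity $Q$, and let $H,J$ be the functions, all as defined in the context. Then the function $$Q\longmapsto (1-\beta)\int_0^1\mathbb{E}[Y^1_\alpha]\,d\alpha+\beta\int_0^1\mathbb{E}[Y^2_\alpha]\,d\alpha$$ is a concave function of $Q\in\mathbb{R}$, and it is maximized uniquely at $$Q^*_{\tilde p,\beta}=F_{\tilde p,\beta}^{-1}\left(\frac{M-C}{M-V}\right),\qquad F_{\tilde p,\beta}(x)=\frac12 H(x)+(1-\beta)\big(J(x)-H(x)\big).$$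
   Context: $C$ is the unit purchase cost, $M$ the unit selling price, $V$ the unit salvage value, $Q$ the order quantity. Put $A=M-V>0$, $a=V-C<0$, $b=M-C>0$ (so $A+a=b$). The newsvendor profit for demand $x$ is $\pi(x)=Ax+aQ$ if $x\le Q$ and $\pi(x)=bQ$ if $x>Q$. For $i=1,2$, $f_i$ is the density of the normal distribution with mean $\mu_i\in\mathbb{R}$ and standard deviation $\sigma_i>0$, and $F_i$ is its cumulative distribution function. The trapezoidal fuzzy number $\tilde p=(p_1,p_2,p_3,p_4)$ has $\alpha$-cuts $[p^1_\alpha,p^2_\alpha]$ with $p^1_\alpha=p_1+(p_2-p_1)\alpha$ and $p^2_\alpha=p_4+(p_3-p_4)\alpha$, $0\le\alpha\le1$. For each $\alpha\in[0,1]$, $X^1_\alpha$ and $X^2_\alpha$ are independent real random variables with densities $f_{X^1_\alpha}=p^1_\alpha f_1+(1-p^1_\alpha)f_2$ and $f_{X^2_\alpha}=p^2_\alpha f_1+(1-p^2_\alpha)f_2$. Put $X^{(1)}_\alpha=\min(X^1_\alpha,X^2_\alpha)$ and $X^{(2)}_\alpha=\max(X^1_\alpha,X^2_\alpha)$; the fuzzy demand has $\alpha$-cuts $[X^{(1)}_\alpha,X^{(2)}_\alpha]$. The fuzzy profit has $\alpha$-cuts $[Y^1_\alpha,Y^2_\alpha]$, where $Y^1_\alpha=\min_{x\in[X^{(1)}_\alpha,X^{(2)}_\alpha]}\pi(x)$ and $Y^2_\alpha=\max_{x\in[X^{(1)}_\alpha,X^{(2)}_\alpha]}\pi(x)$.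 Explicitly: if $X^{(1)}_\alpha\le X^{(2)}_\alpha\le Q$ then $Y^1_\alpha=AX^{(1)}_\alpha+aQ$ and $Y^2_\alpha=AX^{(2)}_\alpha+aQ$; if $Q\le X^{(1)}_\alpha\le X^{(2)}_\alpha$ then $Y^1_\alpha=Y^2_\alpha=bQ$; if $X^{(1)}_\alpha\le Q\le X^{(2)}_\alpha$ then $Y^1_\alpha=\min(AX^{(1)}_\alpha+aQ,\,bQ)$ and $Y^2_\alpha=bQ$. Constants: $P_1=\frac{p_1p_3}{3}+\frac{2p_2p_3}{3}+\frac{2p_1p_4}{3}+\frac{p_2p_4}{3}$, $P_2=\frac{p_1+p_2+p_3+p_4}{2}-\frac{p_1p_3}{3}-\frac{2p_1p_4}{3}-\frac{2p_2p_3}{3}-\frac{p_2p_4}{3}$, $P_3=2-(p_1+p_2+p_3+p_4)+\frac{p_1p_3}{3}+\frac{2p_1p_4}{3}+\frac{2p_2p_3}{3}+\frac{p_2p_4}{3}$. Functions: $H(x)=P_1F_1(x)^2+2P_2F_1(x)F_2(x)+P_3F_2(x)^2$, $J(x)=P_1F_1(x)+P_2(F_1(x)+F_2(x))+P_3F_2(x)$. *)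

(* Defs.v *)
From HB Require Import structures.
From mathcomp Require Import all_boot all_order all_algebra.
From mathcomp Require Import all_classical all_reals all_analysis.

Set Implicit Arguments.
Unset Strict Implicit.
Unset Printing Implicit Defensive.

Import Order.TTheory GRing.Theory Num.Theory.
Import numFieldNormedType.Exports.

Local Open Scope classical_set_scope.
Local Open Scope ring_scope.

Definition concave_function (R : realType) (D : set R) (f : R -> R) : Prop :=
  convex_function (D : set (convex_lmodType R^o)) (fun x => - f x : R^o).

Definition independent_RV d (T : measurableType d) (R : realType)
    (P : probability T R) (X Y : {RV P >-> R}) : Prop :=
  forall A B : set R, measurable A -> measurable B ->
    P (X @^-1` A `&` Y @^-1` B) = (P (X @^-1` A) * P (Y @^-1` B))%E.

Definition has_density d (T : measurableType d) (R : realType)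
    (P : probability T R) (X : {RV P >-> R}) (f : R -> R) : Prop :=
  forall A : set R, measurable A ->
    distribution P X A = (\int[lebesgue_measure]_(x in A) (f x)%:E)%E.

Definition normal_cdf (R : realType) (m s x : R) : R :=
  fine (normal_prob m s `]-oo, x]).

Definition mixture_pdf (R : realType) (m1 s1 m2 s2 w x : R) : R :=
  w * normal_pdf m1 s1 x + (1 - w) * normal_pdf m2 s2 x.

Definition trap_lower (R : realType) (p1 p2 alpha : R) : R :=
  p1 + (p2 - p1) * alpha.

Definition trap_upper (R : realType) (p3 p4 alpha : R) : R :=
  p4 + (p3 - p4) * alpha.

Definition newsvendor_profit (R : realType) (M C V Q x : R) : R :=
  if x <= Q then (M - V) * x + (V - C) * Q else (M - C) * Q.

Definition demand_cut (R : realType) (x1 x2 : R) : set R :=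
  `[Num.min x1 x2, Num.max x1 x2].

(* The endpoints of the cut of the fuzzy profit are the minimum and the maximum
   of the profit over the demand cut; [profit_lowerE] and [profit_upperE] show
   that the infimum and supremum below are attained. *)
Definition profit_lower (R : realType) (M C V Q x1 x2 : R) : R :=
  inf (newsvendor_profit M C V Q @` demand_cut x1 x2).

Definition profit_upper (R : realType) (M C V Q x1 x2 : R) : R :=
  sup (newsvendor_profit M C V Q @` demand_cut x1 x2).

Definition expected_lower d (T : measurableType d) (R : realType)
    (P : probability T R) (X1 X2 : R -> {RV P >-> R}) (M C V Q : R) : \bar R :=
  (\int[lebesgue_measure]_(alpha in `[0%R, 1%R])
     'E_P[fun w => profit_lower M C V Q (X1 alpha w) (X2 alpha w)])%E.

Definition expected_upper d (T : measurableType d) (R : realType)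
    (P : probability T R) (X1 X2 : R -> {RV P >-> R}) (M C V Q : R) : \bar R :=
  (\int[lebesgue_measure]_(alpha in `[0%R, 1%R])
     'E_P[fun w => profit_upper M C V Q (X1 alpha w) (X2 alpha w)])%E.

(* Only meaningful when both integrals are finite. *)
Definition expected_profit d (T : measurableType d) (R : realType)
    (P : probability T R) (X1 X2 : R -> {RV P >-> R}) (M C V beta Q : R) : R :=
  (1 - beta) * fine (expected_lower X1 X2 M C V Q)
  + beta * fine (expected_upper X1 X2 M C V Q).

Definition P1 (R : realType) (p1 p2 p3 p4 : R) : R :=
  p1 * p3 / 3 + 2 * p2 * p3 / 3 + 2 * p1 * p4 / 3 + p2 * p4 / 3.

Definition P2 (R : realType) (p1 p2 p3 p4 : R) : R :=
  (p1 + p2 + p3 + p4) / 2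
  - p1 * p3 / 3 - 2 * p1 * p4 / 3 - 2 * p2 * p3 / 3 - p2 * p4 / 3.

Definition P3 (R : realType) (p1 p2 p3 p4 : R) : R :=
  2 - (p1 + p2 + p3 + p4)
  + p1 * p3 / 3 + 2 * p1 * p4 / 3 + 2 * p2 * p3 / 3 + p2 * p4 / 3.

Definition fuzzyH (R : realType) (m1 s1 m2 s2 p1 p2 p3 p4 x : R) : R :=
  let F1 := normal_cdf m1 s1 x in
  let F2 := normal_cdf m2 s2 x in
  P1 p1 p2 p3 p4 * F1 ^+ 2 + 2 * P2 p1 p2 p3 p4 * F1 * F2
  + P3 p1 p2 p3 p4 * F2 ^+ 2.

Definition fuzzyJ (R : realType) (m1 s1 m2 s2 p1 p2 p3 p4 x : R) : R :=
  let F1 := normal_cdf m1 s1 x in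
  let F2 := normal_cdf m2 s2 x in
  P1 p1 p2 p3 p4 * F1 + P2 p1 p2 p3 p4 * (F1 + F2) + P3 p1 p2 p3 p4 * F2.

Definition fuzzyF (R : realType) (m1 s1 m2 s2 p1 p2 p3 p4 beta x : R) : R :=
  let H := fuzzyH m1 s1 m2 s2 p1 p2 p3 p4 x in
  let J := fuzzyJ m1 s1 m2 s2 p1 p2 p3 p4 x in
  1 / 2 * H + (1 - beta) * (J - H).

Lemma newsvendor_profit_nondecreasing (R : realType) (M C V Q : R) :
  V < C -> C < M -> {homo newsvendor_profit M C V Q : x y / x <= y}.
Proof.
move=> VC CM x y xy; rewrite /newsvendor_profit.
have A0 : 0 <= M - V by rewrite subr_ge0 ltW// (lt_trans VC).
have bE : (M - C) * Q = (M - V) * Q + (V - C) * Q.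
  by rewrite -mulrDl addrA subrK.
case: ifPn => xQ; case: ifPn => yQ //.
- by rewrite lerD2r ler_wpM2l.
- by rewrite bE lerD2r ler_wpM2l.
- by rewrite (le_trans xy yQ) in xQ.
Qed.

Lemma profit_lowerE (R : realType) (M C V Q x1 x2 : R) : V < C -> C < M ->
  profit_lower M C V Q x1 x2 = newsvendor_profit M C V Q (Num.min x1 x2).
Proof.
move=> VC CM; rewrite /profit_lower.
have mM : Num.min x1 x2 <= Num.max x1 x2 by rewrite ge_min !le_max lexx.
set l := newsvendor_profit _ _ _ _ (Num.min x1 x2).
have lE : (newsvendor_profit M C V Q @` demand_cut x1 x2) l.
  by exists (Num.min x1 x2) => //; rewrite /demand_cut/= in_itv/= lexx mM.
have lb : lbound (newsvendor_profit M C V Q @` demand_cut x1 x2) l.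
  move=> _ [x /= + <-]; rewrite /demand_cut/= in_itv/= => /andP[xm _].
  exact: newsvendor_profit_nondecreasing.
by apply/eqP; rewrite eq_le ge_inf ?lb_le_inf//; exists l.
Qed.

Lemma profit_upperE (R : realType) (M C V Q x1 x2 : R) : V < C -> C < M ->
  profit_upper M C V Q x1 x2 = newsvendor_profit M C V Q (Num.max x1 x2).
Proof.
move=> VC CM; rewrite /profit_upper.
have mM : Num.min x1 x2 <= Num.max x1 x2 by rewrite ge_min !le_max lexx.
set l := newsvendor_profit _ _ _ _ (Num.max x1 x2).
have lE : (newsvendor_profit M C V Q @` demand_cut x1 x2) l.
  by exists (Num.max x1 x2) => //; rewrite /demand_cut/= in_itv/= lexx mM.
have lb : ubound (newsvendor_profit M C V Q @` demand_cut x1 x2) l.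
  move=> _ [x /= + <-]; rewrite /demand_cut/= in_itv/= => /andP[_ xm].
  exact: newsvendor_profit_nondecreasing.
apply/eqP; rewrite eq_le ge_sup//=; last by exists l.
by apply: ub_le_sup => //; exists l.
Qed.

(* Main.v *)
Require Import Defs.
From HB Require Import structures.
From mathcomp Require Import all_boot all_order all_algebra.
From mathcomp Require Import all_classical all_reals all_analysis.
From mathcomp Require Import measurable_realfun ring lra.

Import Order.TTheory GRing.Theory Num.Theory.
Import numFieldNormedType.Exports.

Local Open Scope classical_set_scope.
Local Open Scope ring_scope.

(* With a demand x the profit is b Q - A (Q - x)^+, and
   (Q' - x)^+ - (Q - x)^+ >= (Q' - Q) 1_(x <= Q). Averaging over the outcomes
   and over alpha, the objective G satisfies
     G Q' - G Q <= (Q' - Q) (b - A F Q),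
   because F is the (1 - beta, beta)-combination of the alpha-averaged
   distribution functions G1 + G2 - G1 G2 and G1 G2 of the minimum and the
   maximum of the two demands. Such a family of supergradients gives concavity
   and shows that the zero of b - A F is a maximizer; it is the only one since
   F is injective. No differentiation is needed. *)

(** * Normal distribution functions *)

(** [P1 / 2], [P2] and [P3 / 2] are the averages over alpha of [u * v], [u * (1 - v) + (1 - u) * v]
    and [(1 - u) * (1 - v)], with [u], [v] the weights [trap_lower], [trap_upper]: the chances that
    the two demands both draw the first normal component, one of each, or both the second. Hence
    they are nonnegative with sum 1, and F is a convex combination of three functions [mix_cdf],
    each strictly increasing in x with values strictly between 0 and 1. This yields injectivity even
    when some weight vanishes or beta is 0 or 1. The demands are tied to alpha only through their
    laws, so nothing is known about their joint behaviour in alpha and the outcome. Integrals over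
    alpha are therefore reached through half-line probabilities, which are polynomial in alpha.
    Absolute moments bounded uniformly in alpha keep all integrals finite; otherwise [fine] in
    [expected_profit] would turn an infinite value into 0. *)

Lemma normal_pdf_gt0 {R : realType} (m s x : R) :
  s != 0 -> 0 < normal_pdf m s x.
Proof.
move=> s0; rewrite normal_pdfE//= mulr_gt0 ?normal_peak_gt0//.
exact: expR_gt0.
Qed.

Lemma normal_prob_oc {R : realType} (m s x y : R) : x <= y ->
  normal_prob m s `]x, y] = (normal_cdf m s y - normal_cdf m s x)%:E.
Proof.
move=> xy; rewrite EFinB /normal_cdf !fineK ?fin_num_measure//.
have -> : `]-oo, y]%classic = `]-oo, x]%classic `|` `]x, y]%classic :> set R.
  by rewrite -itv_bndbnd_setU// bnd_simp.
rewrite measureU//=; last first.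
  apply/seteqP; split=> // z /=; rewrite !in_itv/= => -[zx /andP[xz _]].
  by move: (le_lt_trans zx xz); rewrite ltxx.
by rewrite [X in (X - _)%E]addeC addeK// fin_num_measure.
Qed.

(** On the compact [[x, y]] the continuous positive density attains a positive minimum at some [c];
    the mass of []x, y]] is at least this minimum times the length. *)
Lemma normal_cdf_increasing {R : realType} (m s x y : R) : s != 0 -> x < y ->
  normal_cdf m s x < normal_cdf m s y.
Proof.
move=> s0 xy; rewrite -subr_gt0 -lte_fin -normal_prob_oc ?ltW//.
have [c _ cP] : exists2 c, c \in `[x, y]%R &
    forall t, t \in `[x, y]%R -> normal_pdf m s c <= normal_pdf m s t.
  apply: EVT_min; first exact: ltW.
  by apply: continuous_subspaceT => z; exact: continuous_normal_pdf.
apply: (@lt_le_trans _ _ (\int[lebesgue_measure]_(z in `]x, y])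
    (normal_pdf m s c)%:E)%E); last first.
  apply: ge0_le_integral => //=.
  - by move=> z _; rewrite lee_fin normal_pdf_ge0.
  - apply/measurable_EFinP/measurable_funTS; exact: measurable_normal_pdf.
  - move=> z; rewrite in_itv/= => /andP[xz zy].
    by rewrite lee_fin cP// in_itv/= ltW.
rewrite integral_cst//= lebesgue_measure_itv/= lte_fin xy -EFinD -EFinM lte_fin.
by rewrite mulr_gt0 ?subr_gt0 ?normal_pdf_gt0.
Qed.

Lemma normal_cdf_lipschitz {R : realType} (m s x y : R) : s != 0 -> x <= y ->
  normal_cdf m s y - normal_cdf m s x <= normal_peak s * (y - x).
Proof.
move=> s0 xy; rewrite -lee_fin -normal_prob_oc//.
apply: (@le_trans _ _ (\int[lebesgue_measure]_(z in `]x, y])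
    (normal_peak s)%:E)%E); last first.
  rewrite integral_cst//= lebesgue_measure_itv/= lte_fin.
  case: ltP => yx; first by rewrite -EFinD -EFinM.
  by rewrite mule0 lee_fin mulr_ge0 ?normal_peak_ge0 ?subr_ge0.
apply: ge0_le_integral => //=.
- by move=> z _; rewrite lee_fin normal_pdf_ge0.
- apply/measurable_EFinP/measurable_funTS; exact: measurable_normal_pdf.
- by move=> z _; rewrite lee_fin normal_pdf_ub.
Qed.

Lemma normal_cdf_continuous {R : realType} (m s : R) : s != 0 ->
  continuous (normal_cdf m s).
Proof.
move=> s0 x.
have k0 : 0 < normal_peak s by exact: normal_peak_gt0.
have dist y : `|normal_cdf m s x - normal_cdf m s y| <= normal_peak s * `|x - y|.
  wlog yx : x y / y <= x.
    move=> H; have [/H//|/ltW/H] := leP y x.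
    by rewrite distrC [X in _ * X]distrC.
  rewrite (ger0_norm (_ : 0 <= x - y)) ?subr_ge0//.
  rewrite ger0_norm ?normal_cdf_lipschitz// subr_ge0.
  move: yx; rewrite le_eqVlt => /predU1P[->//|yx].
  exact/ltW/normal_cdf_increasing.
apply/cvgrPdist_lt => e e0; near=> y.
apply: (le_lt_trans (dist y)); rewrite mulrC -ltr_pdivlMr//.
near: y; apply: cvgr_dist_lt => //; exact: divr_gt0.
Unshelve. all: by end_near. Qed.

(** The identity as a random variable under [normal_prob m s] turns [normal_cdf] into a [cdf], whose
    limits at infinity are known. *)
Definition id_measurableTypeR (R : realType) : measurableTypeR R -> R := idfun.

HB.instance Definition _ (R : realType) :=
  @isMeasurableFun.Build _ _ _ _ (@id_measurableTypeR R)
    (@measurable_id _ _ setT).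

Lemma normal_cdfE {R : realType} (m s : R) : normal_cdf m s =
  fine \o cdf (@id_measurableTypeR R : {RV (normal_prob m s) >-> R}).
Proof. by []. Qed.

Lemma cvg_normal_cdfNy0 {R : realType} (m s : R) :
  normal_cdf m s x @[x --> -oo] --> (0 : R).
Proof. by rewrite normal_cdfE; exact/fine_cvg/cvg_cdfNy0. Qed.

Lemma cvg_normal_cdfy1 {R : realType} (m s : R) :
  normal_cdf m s x @[x --> +oo] --> (1 : R).
Proof. by rewrite normal_cdfE; exact/fine_cvg/cvg_cdfy1. Qed.

Lemma normal_cdf_itv01 {R : realType} (m s x : R) : s != 0 ->
  0 < normal_cdf m s x < 1.
Proof.
move=> s0; have F01 y : 0 <= normal_cdf m s y <= 1.
  rewrite fine_ge0//= -lee_fin fineK ?fin_num_measure//.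
  exact: probability_le1.
(* The weak bounds at the neighbours [x - 1] and [x + 1] become strict at [x] by strict
   monotonicity. *)
have /andP[F0 _] := F01 (x - 1); have /andP[_ F1] := F01 (x + 1).
rewrite (le_lt_trans F0)/= ?(lt_le_trans _ F1)//;
  apply: normal_cdf_increasing => //; lra.
Qed.

(** * The distribution function of the fuzzy demand *)

(** Weights with sum 1 are not all zero: a term with positive weight grows strictly, and the others
    do not decrease. *)
Lemma convex_comb3_lt {R : realType} (w1 w2 w3 x1 x2 x3 y1 y2 y3 : R) :
  0 <= w1 -> 0 <= w2 -> 0 <= w3 -> w1 + w2 + w3 = 1 ->
  x1 < y1 -> x2 < y2 -> x3 < y3 ->
  w1 * x1 + w2 * x2 + w3 * x3 < w1 * y1 + w2 * y2 + w3 * y3.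
Proof.
move=> w10 w20 w30 w x1y1 x2y2 x3y3.
have h1 : 0 <= w1 * (y1 - x1) by rewrite mulr_ge0// subr_ge0 ltW.
have h2 : 0 <= w2 * (y2 - x2) by rewrite mulr_ge0// subr_ge0 ltW.
have h3 : 0 <= w3 * (y3 - x3) by rewrite mulr_ge0// subr_ge0 ltW.
have [w1p|] := ltP 0 w1.
  have : 0 < w1 * (y1 - x1) by rewrite mulr_gt0// subr_gt0.
  lra.
have [w2p|] := ltP 0 w2.
  have : 0 < w2 * (y2 - x2) by rewrite mulr_gt0// subr_gt0.
  lra.
move=> w2n w1n; have : 0 < w3 * (y3 - x3) by rewrite mulr_gt0 ?subr_gt0//; lra.
lra.
Qed.

Lemma convex_comb2_lt {R : realType} (w x1 x2 y1 y2 : R) :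
  0 <= w <= 1 -> x1 < y1 -> x2 < y2 ->
  (1 - w) * x1 + w * x2 < (1 - w) * y1 + w * y2.
Proof.
move=> /andP[w0 w1] xy1 xy2.
have := @convex_comb3_lt R (1 - w) w 0 x1 x2 0 y1 y2 1.
rewrite !mul0r !addr0 subrK; apply => //; first by rewrite subr_ge0.
Qed.

(** [a] and [b] stand for the distribution functions of two independent demands at one point; [beta]
    weighs the maximum against the minimum. *)
Definition mix_cdf {R : realType} (beta a b : R) : R :=
  (1 - beta) * (a + b - a * b) + beta * (a * b).

Lemma mix_cdf_itv01 {R : realType} (beta a b : R) : 0 <= beta <= 1 ->
  0 < a < 1 -> 0 < b < 1 -> 0 < mix_cdf beta a b < 1.
Proof.
rewrite /mix_cdf => be01 /andP[a0 a1] /andP[b0 b1].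
have ab : 0 < a * b by exact: mulr_gt0.
have ab1 : a * b < a by rewrite gtr_pMr.
have ab' : 0 < (1 - a) * (1 - b) by rewrite mulr_gt0 ?subr_gt0.
apply/andP; split.
  by have := @convex_comb2_lt R beta 0 0 _ _ be01 _ ab;
    rewrite !mulr0 addr0; apply; lra.
have := @convex_comb2_lt R beta (a + b - a * b) (a * b) 1 1 be01.
by rewrite !mulr1 subrK; apply; lra.
Qed.

(** The minimum part is handled through its complement [(1 - a) * (1 - b)], a product of positive
    decreasing factors. *)
Lemma mix_cdf_lt {R : realType} (beta a b a' b' : R) : 0 <= beta <= 1 ->
  0 < a < a' -> a' < 1 -> 0 < b < b' -> b' < 1 ->
  mix_cdf beta a b < mix_cdf beta a' b'.
Proof.
rewrite /mix_cdf => be01 /andP[a0 aa'] a'1 /andP[b0 bb'] b'1.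
have ab : a * b < a' * b' by apply: ltr_pM => //; exact: ltW.
have ab' : (1 - a') * (1 - b') < (1 - a) * (1 - b) by apply: ltr_pM; lra.
by apply: convex_comb2_lt => //; lra.
Qed.

Lemma P1_ge0 {R : realType} (p1 p2 p3 p4 : R) :
  0 <= p1 -> p1 <= p2 -> p2 <= p3 -> p3 <= p4 -> p4 <= 1 ->
  0 <= P1 p1 p2 p3 p4.
Proof.
move=> hp1 hp12 hp23 hp34 hp4.
have p20 := le_trans hp1 hp12; have p30 := le_trans p20 hp23.
have p40 := le_trans p30 hp34.
by rewrite /P1 !addr_ge0// divr_ge0// !mulr_ge0.
Qed.

Lemma P2_ge0 {R : realType} (p1 p2 p3 p4 : R) :
  0 <= p1 -> p1 <= p2 -> p2 <= p3 -> p3 <= p4 -> p4 <= 1 ->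
  0 <= P2 p1 p2 p3 p4.
Proof.
move=> hp1 hp12 hp23 hp34 hp4.
(* Summed with the coefficients 1/3, 2/3, 2/3, 1/3 of [P2], in which each [p] has total weight 1,
   these bounds give exactly half the sum of the four [p]. *)
have xy (x y : R) : 0 <= x <= 1 -> 0 <= y <= 1 ->
    x * y <= (x + y) / 2.
  move=> /andP[x0 x1] /andP[y0 y1]; nra.
have h13 := xy p1 p3; have h14 := xy p1 p4.
have h23 := xy p2 p3; have h24 := xy p2 p4.
have {h13} : p1 * p3 <= (p1 + p3) / 2 by apply: h13; apply/andP; split; lra.
have {h14} : p1 * p4 <= (p1 + p4) / 2 by apply: h14; apply/andP; split; lra.
have {h23} : p2 * p3 <= (p2 + p3) / 2 by apply: h23; apply/andP; split; lra.
have {h24} : p2 * p4 <= (p2 + p4) / 2 by apply: h24; apply/andP; split; lra.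
rewrite /P2; lra.
Qed.

(** [P3] is [P1] with every [p] replaced by [1 - p]. *)
Lemma P3_ge0 {R : realType} (p1 p2 p3 p4 : R) :
  0 <= p1 -> p1 <= p2 -> p2 <= p3 -> p3 <= p4 -> p4 <= 1 ->
  0 <= P3 p1 p2 p3 p4.
Proof.
move=> hp1 hp12 hp23 hp34 hp4.
have h13 : 0 <= (1 - p1) * (1 - p3) by apply: mulr_ge0; lra.
have h14 : 0 <= (1 - p1) * (1 - p4) by apply: mulr_ge0; lra.
have h23 : 0 <= (1 - p2) * (1 - p3) by apply: mulr_ge0; lra.
have h24 : 0 <= (1 - p2) * (1 - p4) by apply: mulr_ge0; lra.
rewrite /P3; nra.
Qed.

Lemma P_sum {R : realType} (p1 p2 p3 p4 : R) :
  P1 p1 p2 p3 p4 / 2 + P2 p1 p2 p3 p4 + P3 p1 p2 p3 p4 / 2 = 1.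
Proof. by rewrite /P1 /P2 /P3; field. Qed.

Lemma fuzzyFE {R : realType} (m1 s1 m2 s2 p1 p2 p3 p4 beta x : R) :
  fuzzyF m1 s1 m2 s2 p1 p2 p3 p4 beta x =
  P1 p1 p2 p3 p4 / 2 * mix_cdf beta (normal_cdf m1 s1 x) (normal_cdf m1 s1 x)
  + P2 p1 p2 p3 p4 * mix_cdf beta (normal_cdf m1 s1 x) (normal_cdf m2 s2 x)
  + P3 p1 p2 p3 p4 / 2 * mix_cdf beta (normal_cdf m2 s2 x) (normal_cdf m2 s2 x).
Proof.
rewrite /fuzzyF /fuzzyH /fuzzyJ /mix_cdf.
move: (P1 _ _ _ _) (P2 _ _ _ _) (P3 _ _ _ _) (normal_cdf m1 s1 x).
by move: (normal_cdf m2 s2 x) => b w1 w2 w3 a; field.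
Qed.

Section fuzzyF_bijective.
Context {R : realType} (m1 s1 m2 s2 p1 p2 p3 p4 beta : R).
Hypotheses (s10 : s1 != 0) (s20 : s2 != 0).
Hypotheses (hp1 : 0 <= p1) (hp12 : p1 <= p2) (hp23 : p2 <= p3)
  (hp34 : p3 <= p4) (hp4 : p4 <= 1) (hbeta : 0 <= beta <= 1).
Let F := fuzzyF m1 s1 m2 s2 p1 p2 p3 p4 beta.
Let w1 := P1 p1 p2 p3 p4 / 2.
Let w2 := P2 p1 p2 p3 p4.
Let w3 := P3 p1 p2 p3 p4 / 2.
Let w10 : 0 <= w1. Proof. by rewrite divr_ge0// P1_ge0. Qed.
Let w20 : 0 <= w2. Proof. exact: P2_ge0. Qed.
Let w30 : 0 <= w3. Proof. by rewrite divr_ge0// P3_ge0. Qed.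
Let w_sum : w1 + w2 + w3 = 1. Proof. exact: P_sum. Qed.

Lemma fuzzyF_increasing x y : x < y -> F x < F y.
Proof.
move=> xy; rewrite /F !fuzzyFE.
have [F1x F2x] := (normal_cdf_itv01 m1 s1 x s10, normal_cdf_itv01 m2 s2 x s20).
have /andP[_ F1y] := normal_cdf_itv01 m1 s1 y s10.
have /andP[_ F2y] := normal_cdf_itv01 m2 s2 y s20.
have {}F1x : 0 < normal_cdf m1 s1 x < normal_cdf m1 s1 y.
  by case/andP: F1x => -> _; rewrite normal_cdf_increasing.
have {}F2x : 0 < normal_cdf m2 s2 x < normal_cdf m2 s2 y.
  by case/andP: F2x => -> _; rewrite normal_cdf_increasing.
by apply: convex_comb3_lt => //; exact: mix_cdf_lt.
Qed.

Lemma fuzzyF_itv01 x : 0 < F x < 1.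
Proof.
rewrite /F fuzzyFE.
have F1 := normal_cdf_itv01 m1 s1 x s10; have F2 := normal_cdf_itv01 m2 s2 x s20.
have /andP[k1 k1'] := mix_cdf_itv01 _ _ _ hbeta F1 F1.
have /andP[k2 k2'] := mix_cdf_itv01 _ _ _ hbeta F1 F2.
have /andP[k3 k3'] := mix_cdf_itv01 _ _ _ hbeta F2 F2.
apply/andP; split.
  have := convex_comb3_lt _ _ _ _ _ _ _ _ _ w10 w20 w30 w_sum k1 k2 k3.
  by rewrite !mulr0 !addr0.
have := convex_comb3_lt _ _ _ _ _ _ _ _ _ w10 w20 w30 w_sum k1' k2' k3'.
by rewrite !mulr1 w_sum.
Qed.

(** The filter is arbitrary, so that continuity and both limits at infinity are instances. *)
Let fuzzyF_cvg (D : set_system R) (FD : Filter D) (a b : R) :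
  normal_cdf m1 s1 x @[x --> D] --> a -> normal_cdf m2 s2 x @[x --> D] --> b ->
  F x @[x --> D] -->
    w1 * mix_cdf beta a a + w2 * mix_cdf beta a b + w3 * mix_cdf beta b b.
Proof.
move=> Ha Hb; rewrite /F (funext (fuzzyFE m1 s1 m2 s2 p1 p2 p3 p4 beta)).
have kcvg (f g : R -> R) (u v : R) : f x @[x --> D] --> u ->
    g x @[x --> D] --> v ->
    mix_cdf beta (f x) (g x) @[x --> D] --> mix_cdf beta u v.
  move=> fu gv; rewrite /mix_cdf.
  apply: (@cvgD _ R^o).
    apply: (@cvgM _ R) => //; first exact: cvg_cst.
    by apply: (@cvgB _ R^o); [exact: (@cvgD _ R^o)|exact: (@cvgM _ R)].
  by apply: (@cvgM _ R); [exact: cvg_cst|exact: (@cvgM _ R)].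
apply: (@cvgD _ R^o); [apply: (@cvgD _ R^o)|];
  (apply: (@cvgM _ R); [exact: cvg_cst|exact: kcvg]).
Qed.

Lemma fuzzyF_continuous : continuous F.
Proof.
move=> x; rewrite /continuous_at [X in _ --> X]fuzzyFE.
by apply: fuzzyF_cvg; exact: normal_cdf_continuous.
Qed.

Lemma cvg_fuzzyFNy0 : F x @[x --> -oo] --> (0 : R).
Proof.
have := @fuzzyF_cvg _ _ _ _ (cvg_normal_cdfNy0 m1 s1) (cvg_normal_cdfNy0 m2 s2).
by rewrite /mix_cdf !(mulr0,addr0,subr0); apply; exact: _.
Qed.

Lemma cvg_fuzzyFy1 : F x @[x --> +oo] --> (1 : R).
Proof.
have := @fuzzyF_cvg _ _ _ _ (cvg_normal_cdfy1 m1 s1) (cvg_normal_cdfy1 m2 s2).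
by rewrite /mix_cdf !mulr1 addrK mulr1 subrK !mulr1 w_sum; apply; exact: _.
Qed.

Lemma fuzzyF_bij : set_bij [set: R] `]0, 1[ F.
Proof.
split.
- by move=> x _ /=; rewrite in_itv/=; exact: fuzzyF_itv01.
- move=> x y _ _ /eqP; apply: contraTeq;
    rewrite neq_lt => /orP[] /fuzzyF_increasing;
    by [move=> /lt_eqF->|move=> /gt_eqF->].
- move=> v /=; rewrite in_itv/= => /andP[v0 v1].
  have [x [_ xv]] : exists x, x \is Num.real /\ F x < v.
    have /cvgrPdist_lt/(_ v v0)[x [xr xP]] := cvg_fuzzyFNy0.
    (* The filters at infinity only control points strictly beyond the threshold, whence [x - 1]
       here and [y + 1] below. *)
    exists (x - 1); split; first exact: num_real.
    have /= := xP (x - 1); rewrite sub0r normrN => H.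
    by apply: (le_lt_trans (ler_norm _)); apply: H; rewrite ltrBlDr ltrDl.
  have [y yv] : exists y, v < F y.
    have v1' : 0 < 1 - v by rewrite subr_gt0.
    have /cvgrPdist_lt/(_ _ v1')[y [yr yP]] := cvg_fuzzyFy1.
    exists (y + 1).
    have /= H := yP (y + 1).
    have := le_lt_trans (ler_norm _) (H _); rewrite ltrDl ltr01 => /(_ isT).
    lra.
  have xy : x <= y.
    have [//|/fuzzyF_increasing Fyx] := leP x y.
    by move: (lt_trans (lt_trans yv Fyx) xv); rewrite ltxx.
  have [||c _ cv] := @IVT R F x y v xy.
  + by apply: continuous_subspaceT; exact: fuzzyF_continuous.
  + by rewrite ge_min le_max (ltW xv) (ltW yv) orbT.
  by exists c.
Qed.

End fuzzyF_bijective.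

(** * Densities and absolute moments *)

(** The change of variables is available for the Radon-Nikodym derivative; [h] has the same integral
    over every measurable set, hence agrees with it almost everywhere. *)
Lemma ge0_integral_density d (T : measurableType d) {R : realType}
    (nu : {finite_measure set T -> \bar R})
    (mu : {sigma_finite_measure set T -> \bar R}) (h : T -> R)
    (f : T -> \bar R) :
  measurable_fun [set: T] h ->
  (forall A, measurable A -> nu A = (\int[mu]_(x in A) (h x)%:E)%E) ->
  measurable_fun [set: T] f -> (forall x, 0 <= f x)%E ->
  (\int[nu]_x f x = \int[mu]_x (f x * (h x)%:E))%E.
Proof.
move=> mh nuE mf f0.
have numu : nu `<< mu.
  apply/null_content_dominatesP => A mA muA0; rewrite nuE//.
  by apply: null_set_integral => //; exact/measurable_EFinP/measurable_funTS.
have mRN := measurable_int _ (Radon_Nikodym_SigmaFinite.f_integrable numu).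
rewrite -(Radon_Nikodym_SigmaFinite.change_of_variables numu)//.
apply: ae_eq_integral => //.
- exact: emeasurable_funM.
- by apply: emeasurable_funM => //; exact/measurable_EFinP.
apply: ae_eqe_mul2l; apply: integral_ae_eq => //.
- exact: Radon_Nikodym_SigmaFinite.f_integrable.
- exact/measurable_EFinP.
- by move=> A _ mA; rewrite -Radon_Nikodym_SigmaFinite.f_integral// nuE.
Qed.

(* Widening the bell curve absorbs the factor [|x|], since
   [1 + t <= expR t] applies to [t = 3 (x - m)^2 / (8 s^2)]. *)
Lemma normal_pdf_abs_le {R : realType} (m s : R) : 0 < s ->
  exists2 K : R, 0 <= K &
    forall x, `|x| * normal_pdf m s x <= K * normal_pdf m (2 * s) x.
Proof.
move=> s0; have ts0 : 0 < 2 * s by rewrite mulr_gt0.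
have peak0 := normal_peak_ge0 s.
have peak20 : 0 < normal_peak (2 * s) by rewrite normal_peak_gt0// gt_eqF.
exists (normal_peak s / normal_peak (2 * s) * (`|m| + s)).
  by rewrite mulr_ge0 ?divr_ge0 ?addr_ge0// ltW.
move=> x; rewrite !normal_pdfE ?gt_eqF//=.
set v := `|x - m|; pose t := 3 * v ^+ 2 / (8 * s ^+ 2).
have v0 : 0 <= v by exact: normr_ge0.
have vE : (x - m) ^+ 2 = v ^+ 2 by rewrite real_normK// num_real.
have -> : normal_fun m s x = normal_fun m (2 * s) x * expR (- t).
  rewrite /normal_fun -expRD vE /t -!(mulr_natr (_ ^+ 2) 2); congr expR.
  by move: v {t v0 vE} => w; field; rewrite gt_eqF.
rewrite mulrCA -[X in _ <= X]mulrA [X in _ <= _ / _ * X]mulrCA.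
rewrite [X in _ <= X]mulrA divfK; last by rewrite gt_eqF.
apply: ler_wpM2l => //.
rewrite mulrCA [X in _ <= X]mulrC; apply: ler_wpM2l.
  exact: normal_fun_ge0.
rewrite expRN ler_pdivrMr ?expR_gt0//.
have t0 : 0 <= t.
  by apply: divr_ge0; apply: mulr_ge0; rewrite ?exprn_ge0// ltW.
apply: (@le_trans _ _ ((`|m| + s) * (1 + t))); last first.
  by rewrite ler_wpM2l ?expR_ge1Dx// addr_ge0// ltW.
have xmv : `|x| <= `|m| + v by rewrite -{1}(subrK m x) addrC ler_normD.
have vs : v <= s * (1 + t).
  have -> : s * (1 + t) = v + ((2 * v - 2 * s) ^+ 2 + (2 * s) ^+ 2 - v ^+ 2)
      / (8 * s).
    by rewrite /t; move: v {v0 vE t t0 xmv} => w; field; rewrite gt_eqF.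
  rewrite lerDl; apply: divr_ge0; last by apply: mulr_ge0; rewrite // ltW.
  (* Completing the square: the numerator is [3 * v ^+ 2 - 8 * s * v + 8 * s ^+ 2], of negative
     discriminant in [v]. *)
  rewrite (_ : _ - _ = 3 * (v - 4 / 3 * s) ^+ 2 + 8 / 3 * s ^+ 2); last first.
    by move: v {v0 vE t t0 xmv} => w; field.
  by apply: addr_ge0; apply: mulr_ge0; rewrite ?sqr_ge0// divr_ge0.
have mt : 0 <= `|m| * t by rewrite mulr_ge0.
rewrite mulrDl mulrDr mulr1; apply: (le_trans xmv); lra.
Qed.

Lemma normal_abs_moment_lty {R : realType} (m s : R) : 0 < s ->
  (\int[lebesgue_measure]_x (`|x| * normal_pdf m s x)%:E < +oo)%E.
Proof.
move=> /(normal_pdf_abs_le m)[K K0 Kle].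
apply: (@le_lt_trans _ _
    (\int[lebesgue_measure]_x (K%:E * (normal_pdf m (2 * s) x)%:E))%E).
  apply: ge0_le_integral => //=.
  - by move=> x _; rewrite lee_fin mulr_ge0// normal_pdf_ge0.
  - apply/measurable_EFinP; apply: measurable_funM => //.
    exact: measurable_normal_pdf.
  - apply/measurable_EFinP; apply: measurable_funM => //.
    exact: measurable_normal_pdf.
  - by move=> x _; rewrite -EFinM lee_fin.
rewrite ge0_integralZl//=.
- by rewrite integral_normal_pdf mule1 ltry.
- by apply/measurable_EFinP; exact: measurable_normal_pdf.
- by move=> x _; rewrite lee_fin normal_pdf_ge0.
Qed.

(** * Expected shortage *)

Definition shortage {R : realType} (Q x : R) : R := Num.max 0 (Q - x).

Lemma shortage_ge0 {R : realType} (Q x : R) : 0 <= shortage Q x.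
Proof. by rewrite /shortage le_max lexx. Qed.

Lemma shortage_le {R : realType} (Q x : R) : shortage Q x <= `|Q| + `|x|.
Proof.
by rewrite /shortage ge_max addr_ge0//= (le_trans (ler_norm _))// ler_normB.
Qed.

(** The shortage is convex in [Q], and the indicator of [x <= Q] is its right derivative. This
    choice of subgradient has the distribution function at [Q] as its expectation. *)
Lemma shortage_subgradient {R : realType} (Q Q' x : R) :
  (Q' - Q) * (x <= Q)%R%:R <= shortage Q' x - shortage Q x.
Proof.
rewrite /shortage; have [xQ|Qx] := leP x Q; rewrite ?mulr1 ?mulr0.
  have -> : Num.max 0 (Q - x) = Q - x by apply: max_r; rewrite subr_ge0.
  have : Q' - x <= Num.max 0 (Q' - x) by rewrite le_max lexx orbT.
  lra.
have -> : Num.max 0 (Q - x) = 0 by apply: max_l; rewrite subr_le0 ltW.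
by rewrite subr0 le_max lexx.
Qed.

Lemma newsvendor_profitE {R : realType} (M C V Q x : R) :
  newsvendor_profit M C V Q x = (M - C) * Q - (M - V) * shortage Q x.
Proof.
rewrite /newsvendor_profit /shortage; case: leP => xQ.
  by rewrite max_r ?subr_ge0//; ring.
by rewrite max_l ?subr_le0 ?ltW// mulr0 subr0.
Qed.

Lemma measurable_shortage {d} {T : measurableType d} {R : realType} (Q : R)
    {X : T -> R} :
  measurable_fun [set: T] X -> measurable_fun [set: T] (shortage Q \o X).
Proof.
move=> mX; apply: measurable_maxr => //; exact: measurable_funB.
Qed.

(** Layer cake formula: for [r >= 0] the shortage exceeds [r] exactly when [X < Q - r], which is why
    open half-lines appear. *)
Lemma expectation_shortage {d} {T : measurableType d} {R : realType}
    (P : probability T R) {X : T -> R} (Q : R) :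
  measurable_fun [set: T] X ->
  (\int[P]_w (shortage Q (X w))%:E =
   \int[lebesgue_measure]_(r in `[0%R, +oo[) P (X @^-1` `]-oo, (Q - r)%R[))%E.
Proof.
move=> mX; have mW := measurable_shortage Q mX.
pose W : {RV P >-> R} := mfun_Sub (mem_set mW : (shortage Q \o X) \in mfun).
have W0 w : 0 <= W w by exact: shortage_ge0.
have := ge0_expectation_ccdf W0; rewrite expectation_def => ->.
apply: eq_integral => r; rewrite inE/= in_itv/= andbT => r0.
rewrite /ccdf /distribution /pushforward; congr (P _).
apply/seteqP; split => w /=; rewrite !in_itv/= andbT /shortage lt_max ltNge r0/=;
  rewrite ltrBrDl ltrBrDr => //; lra.
Qed.

(** [Z] will be the minimum or the maximum of the two demands. Open half-lines, with [g], serve the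
    layer cake formula; closed ones, with [h], serve the subgradient. *)
Section mean_shortage.
Context {d} {T : measurableType d} {R : realType} (P : probability T R).
Variables (Z : R -> T -> R) (g h : R -> R -> R) (K : R).
Hypothesis mZ : forall al : R, 0 <= al <= 1 -> measurable_fun [set: T] (Z al).
Hypothesis ZK : forall al : R, 0 <= al <= 1 ->
  (\int[P]_w (`|Z al w|)%:E <= K%:E)%E.
Hypothesis gE : forall al x : R, 0 <= al <= 1 ->
  P (Z al @^-1` `]-oo, x[) = (g al x)%:E.
Hypothesis mg : measurable_fun [set: R * R] (fun z => g z.1 z.2).
Hypothesis hE : forall al x : R, 0 <= al <= 1 ->
  P (Z al @^-1` `]-oo, x]) = (h al x)%:E.
Hypothesis hint : forall x,
  (@lebesgue_measure R).-integrable `[0, 1] (EFin \o h^~ x).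

Let s (Q al : R) : R := \int[P]_w shortage Q (Z al w).

Definition mean_shortage (Q : R) : R :=
  \int[lebesgue_measure]_(al in `[0, 1]) s Q al.

Let bound_integrable (Q al : R) : 0 <= al <= 1 ->
  P.-integrable [set: T] (fun w => (`|Q| + `|Z al w|)%:E).
Proof.
move=> al01; under eq_fun do rewrite EFinD.
apply: integrableD => //; first exact: finite_measure_integrable_cst.
apply/integrableP; split.
  by apply/measurable_EFinP; apply: measurableT_comp => //; exact: mZ.
under eq_integral do rewrite abse_EFin normr_id.
exact: le_lt_trans (ZK _ al01) (ltry _).
Qed.

Let shortage_integrable (Q al : R) : 0 <= al <= 1 ->
  P.-integrable [set: T] (fun w => (shortage Q (Z al w))%:E).
Proof.
move=> al01; apply: le_integrable (bound_integrable Q _ al01) => //.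
  by apply/measurable_EFinP; exact/measurable_shortage/mZ.
move=> w _; rewrite /= lee_fin ger0_norm ?shortage_ge0// ger0_norm ?addr_ge0//.
exact: shortage_le.
Qed.

Let sE (Q al : R) : 0 <= al <= 1 ->
  (s Q al)%:E = (\int[P]_w (shortage Q (Z al w))%:E)%E.
Proof.
move=> al01; rewrite /s /Rintegral fineK//.
exact: integrable_fin_num (shortage_integrable Q _ al01).
Qed.

Let s_ge0 (Q al : R) : 0 <= s Q al.
Proof. by apply: Rintegral_ge0 => w _; exact: shortage_ge0. Qed.

(** The bound does not depend on [al], so measurability in [al] is all that remains for
    integrability over the unit interval. *)
Let s_le (Q al : R) : 0 <= al <= 1 -> s Q al <= `|Q| + K.
Proof.
move=> al01; rewrite -lee_fin sE//.
apply: (@le_trans _ _ (\int[P]_w (`|Q| + `|Z al w|)%:E)%E).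
  apply: ge0_le_integral => //=.
  - by move=> w _; rewrite lee_fin shortage_ge0.
  - by apply/measurable_EFinP; exact/measurable_shortage/mZ.
  - exact: measurable_int (bound_integrable Q _ al01).
  - by move=> w _; rewrite lee_fin shortage_le.
under eq_integral do rewrite EFinD.
rewrite ge0_integralD//=; last first.
  by apply/measurable_EFinP; apply: measurableT_comp => //; exact: mZ.
rewrite [X in (X + _ <= _)%E](_ : _ = `|Q|%:E).
  by rewrite EFinD leeD2l// ZK.
by rewrite integral_cst//= probability_setT mule1.
Qed.

(* By the layer cake formula the inner expectation only involves [g], so that
   Tonelli's theorem gives measurability without any regularity of [Z] in
   [al]. *)
Let s_measurable (Q : R) : measurable_fun (`[0, 1]%classic : set R) (s Q).
Proof.
(* Tonelli asks for a nonnegative integrand on the whole plane, whereas [g] is known to be a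
   probability only for alpha in the unit interval; hence the absolute value. *)
pose f (z : R * R) : \bar R :=
  (\1_(`[0, +oo[%classic : set R) z.2 * `|g z.1 (Q - z.2)|)%:E.
have mf : measurable_fun [set: R * R] f.
  apply/measurable_EFinP; apply: measurable_funM.
    exact: measurableT_comp.
  apply: measurableT_comp => //.
  apply: (measurableT_comp mg (g := fun z : R * R => (z.1, Q - z.2))).
  by apply: measurable_fun_pair => //; exact: measurable_funB.
have f0 z : (0 <= f z)%E by rewrite lee_fin mulr_ge0.
have mF := @measurable_fun_fubini_tonelli_F _ _ _ _ R lebesgue_measure f mf f0.
apply/measurable_EFinP.
apply: (eq_measurable_fun (fubini_F lebesgue_measure f)); last first.
  exact: measurable_funTS.
move=> al; rewrite inE/= in_itv/= => al01.
rewrite /fubini_F sE// expectation_shortage; last exact: mZ.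
rewrite [RHS]integral_mkcond; apply: eq_integral => r _.
rewrite /f/= patchE indicE; case: ifPn => r0; rewrite ?mul0r// mul1r gE//.
by rewrite ger0_norm// -lee_fin -gE.
Qed.

Let s_integrable (Q : R) :
  (@lebesgue_measure R).-integrable `[0, 1] (EFin \o s Q).
Proof.
apply: measurable_bounded_integrable => //.
  by rewrite /= lebesgue_measure_itv/= lte01 -EFinD ltry.
  exact: s_measurable.
exists (`|Q| + K); split; first exact: num_real.
move=> M QM al /=; rewrite in_itv/= => al01.
by rewrite ger0_norm// (le_trans (s_le _ _ al01))// ltW.
Qed.

(** Since the right-hand side is a real number, this also settles finiteness. *)
Lemma expected_newsvendor_profit (M C V Q : R) :
  (\int[lebesgue_measure]_(al in `[0%R, 1%R])
     'E_P[fun w => newsvendor_profit M C V Q (Z al w)])%E =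
  ((M - C) * Q - (M - V) * mean_shortage Q)%:E.
Proof.
have mean (al : R) : 0 <= al <= 1 ->
    ('E_P[fun w => newsvendor_profit M C V Q (Z al w)] =
     ((M - C) * Q - (M - V) * s Q al)%:E)%E.
  move=> al01; rewrite unlock.
  under eq_integral do rewrite newsvendor_profitE EFinB EFinM.
  rewrite integralB//=; [|exact: finite_measure_integrable_cst|]; last first.
    under eq_fun do rewrite EFinM.
    by apply: integrableZl => //; exact: shortage_integrable.
  rewrite integral_cst//= probability_setT mule1.
  under eq_integral do rewrite EFinM.
  by rewrite integralZl ?shortage_integrable// -sE// -EFinM -EFinB.
transitivity (\int[lebesgue_measure]_(al in `[0%R, 1%R])
    ((M - C) * Q - (M - V) * s Q al)%:E)%E.
  by apply: eq_integral => al; rewrite inE/= in_itv/=; exact: mean.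
under eq_integral do rewrite EFinB.
have sM : (@lebesgue_measure R).-integrable `[0, 1]
    (fun al => ((M - V) * s Q al)%:E).
  exact: (integrableZl _ _ (s_integrable Q)).
have cst_int : (@lebesgue_measure R).-integrable `[0, 1]
    (fun=> ((M - C) * Q)%:E).
  apply: continuous_compact_integrable; first exact: segment_compact.
  by apply: continuous_subspaceT => x; exact: cvg_cst.
rewrite integralB//= integral_cst//= lebesgue_measure_itv/= lte01 oppr0 adde0 mule1.
under eq_integral do rewrite EFinM.
rewrite integralZl ?s_integrable//.
rewrite (_ : (\int[_]_(x in _) _)%E = (mean_shortage Q)%:E).
  by rewrite -EFinM -EFinB.
by rewrite /mean_shortage /Rintegral fineK// integrable_fin_num// s_integrable.
Qed.

Lemma mean_shortage_subgradient (Q Q' : R) :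
  (Q' - Q) * \int[lebesgue_measure]_(al in `[0, 1]) h al Q <=
  mean_shortage Q' - mean_shortage Q.
Proof.
rewrite /mean_shortage -RintegralB ?s_integrable// -RintegralZl//.
apply: le_Rintegral => //.
- exact: (integrableZl _ _ (hint Q)).
- exact: (integrableB _ (s_integrable Q') (s_integrable Q)).
move=> al; rewrite /= in_itv/= => al01.
rewrite /s -RintegralB ?shortage_integrable//.
have mA : measurable (Z al @^-1` `]-oo, Q]).
  by rewrite -[X in measurable X]setTI; exact: mZ.
have -> : h al Q = \int[P]_w \1_(Z al @^-1` `]-oo, Q]) w.
  by rewrite /Rintegral integral_indic//= setIT (hE _ _ al01).
have indic_int : P.-integrable [set: T] (EFin \o \1_(Z al @^-1` `]-oo, Q])).
  exact: integrable_indic.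
rewrite -RintegralZl//; apply: le_Rintegral => //.
- exact: (integrableZl _ _ indic_int).
- exact: (integrableB _ (shortage_integrable Q' _ al01)
    (shortage_integrable Q _ al01)).
move=> w _; rewrite indicE/=.
rewrite (_ : (w \in _) = (Z al w <= Q)); first exact: shortage_subgradient.
by apply/idP/idP; rewrite ?inE/= in_itv.
Qed.

End mean_shortage.

(** * Functions with supergradients *)

(** Of the two inequalities at the intermediate point [z], weighted by [t] and [1 - t], the slope
    terms cancel. *)
Lemma supergradient_concave {R : realType} (f g : R -> R) :
  (forall x y, f y - f x <= (y - x) * g x) -> concave_function [set: R] f.
Proof.
move=> fg t x y _ _.
change (- f (t%:num * x + (1 - t%:num) * y) <=
  t%:num * - f x + (1 - t%:num) * - f y).
set z := t%:num * x + (1 - t%:num) * y.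
have t0 : 0 <= t%:num by [].
have t1 : 0 <= 1 - t%:num by rewrite subr_ge0.
have hx := ler_wpM2l t0 (fg z x).
have hy := ler_wpM2l t1 (fg z y).
have : t%:num * ((x - z) * g z) + (1 - t%:num) * ((y - z) * g z) = 0.
  by rewrite /z; ring.
move: hx hy; move: (t%:num) (g z) => u v; lra.
Qed.

(* At a second maximizer y the supergradient at the midpoint m of x0 and y has
   the wrong sign on one side, unless it vanishes, and then m = x0. *)
Lemma supergradient_unique_max {R : realType} (f g : R -> R) (x0 : R) :
  (forall x y, f y - f x <= (y - x) * g x) -> injective g -> g x0 = 0 ->
  forall y, f y <= f x0 ?= iff (y == x0).
Proof.
move=> fg ginj gx0 y.
have le y' : f y' <= f x0 by have := fg x0 y'; rewrite gx0 mulr0 subr_le0.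
apply/leifP; case: eqVneq => [->//|yx0].
rewrite lt_neqAle le andbT; apply/eqP => fyx0.
pose m := (x0 + y) / 2.
have h1 := fg m x0; have h2 := fg m y; have h3 := le m.
have my : y - m = - (x0 - m) by rewrite /m; field.
have gm : (x0 - m) * g m = 0.
  by apply/eqP; rewrite eq_le; apply/andP; split; nra.
move/eqP: gm; rewrite mulf_eq0 => /orP[/eqP xm|/eqP gm0].
  by move/eqP: yx0; apply; move: xm; rewrite /m; lra.
have /ginj mx0 : g m = g x0 by rewrite gm0.
by move/eqP: yx0; apply; move: mx0; rewrite /m; lra.
Qed.

(** * Expected profit for mixtures of normal demands *)

Lemma quadratic_integrable {R : realType} (a b c : R) :
  (@lebesgue_measure R).-integrable `[0, 1]
    (fun t => (a + b * t + c * t ^+ 2)%:E).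
Proof.
apply: continuous_compact_integrable; first exact: segment_compact.
apply: continuous_subspaceT => x.
apply: (@cvgD _ R^o); first apply: (@cvgD _ R^o); first exact: cvg_cst.
  by apply: (@cvgM _ R); [exact: cvg_cst|exact: cvg_id].
by apply: (@cvgM _ R); [exact: cvg_cst|exact: exprn_continuous].
Qed.

Lemma Rintegral_quadratic {R : realType} (a b c : R) :
  \int[lebesgue_measure]_(t in `[0, 1]) (a + b * t + c * t ^+ 2) =
  a + b / 2 + c / 3 :> R.
Proof.
pose F (t : R) : R := a * t + b / 2 * t ^+ 2 + c / 3 * t ^+ 3.
have dF (t : R) : is_derive t 1 (F : R^o -> R^o) (a + b * t + c * t ^+ 2).
  by apply: is_derive_eq; rewrite /GRing.scale/=; field.
have Fcont : continuous F.
  move=> t; apply/differentiable_continuous/derivable1_diffP.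
  exact: ex_derive.
rewrite /Rintegral (@continuous_FTC2 _ _ F)//.
- by rewrite -EFinB /F /= !expr1n !expr0n/= !mulr0 !addr0 subr0 !mulr1.
- apply: continuous_subspaceT => x.
  apply: (@cvgD _ R^o); first apply: (@cvgD _ R^o); first exact: cvg_cst.
    by apply: (@cvgM _ R); [exact: cvg_cst|exact: cvg_id].
  by apply: (@cvgM _ R); [exact: cvg_cst|exact: exprn_continuous].
- split; first by move=> t _; exact: ex_derive.
    exact/cvg_at_right_filter/Fcont.
  exact/cvg_at_left_filter/Fcont.
- by move=> t _; rewrite derive1E; have dFt := dF t; exact: derive_val.
Qed.

Lemma has_density_mixture_prob {d} {T : measurableType d} {R : realType}
    (P : probability T R) (X : {RV P >-> R}) (m1 s1 m2 s2 w : R) (A : set R) :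
  has_density X (mixture_pdf m1 s1 m2 s2 w) -> 0 <= w <= 1 -> measurable A ->
  P (X @^-1` A) =
  (w * fine (normal_prob m1 s1 A) + (1 - w) * fine (normal_prob m2 s2 A))%:E.
Proof.
move=> Xd /andP[w0 w1] mA; rewrite -[LHS]/(distribution P X A) Xd//.
rewrite /mixture_pdf; under eq_integral do rewrite EFinD !EFinM.
have w1' : 0 <= 1 - w by rewrite subr_ge0.
have mpdf (m s : R) : measurable_fun A (fun x => (normal_pdf m s x)%:E).
  by apply/measurable_EFinP/measurable_funTS; exact: measurable_normal_pdf.
rewrite ge0_integralD//=.
- have NE (m s : R) : (\int[lebesgue_measure]_(x in A) (normal_pdf m s x)%:E =
      (fine (normal_prob m s A))%:E)%E by rewrite fineK// fin_num_measure.
  rewrite !ge0_integralZl//=; last 4 first.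
  + exact: mpdf.
  + by move=> x _; rewrite lee_fin normal_pdf_ge0.
  + exact: mpdf.
  + by move=> x _; rewrite lee_fin normal_pdf_ge0.
  by rewrite !NE.
- by move=> x _; rewrite -EFinM lee_fin mulr_ge0// normal_pdf_ge0.
- by apply: emeasurable_funM => //; exact: mpdf.
- by move=> x _; rewrite -EFinM lee_fin mulr_ge0// normal_pdf_ge0.
- by apply: emeasurable_funM => //; exact: mpdf.
Qed.

Definition normal_abs_moment {R : realType} (m s : R) : R :=
  \int[lebesgue_measure]_x (`|x| * normal_pdf m s x).

(** Bounding both mixture weights by 1 makes the bound independent of [w], hence uniform in
    alpha. *)
Lemma has_density_mixture_abs_moment {d} {T : measurableType d} {R : realType}
    (P : probability T R) (X : {RV P >-> R}) (m1 s1 m2 s2 w : R) :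
  0 < s1 -> 0 < s2 ->
  has_density X (mixture_pdf m1 s1 m2 s2 w) -> 0 <= w <= 1 ->
  (\int[P]_t (`|X t|)%:E <=
   (normal_abs_moment m1 s1 + normal_abs_moment m2 s2)%:E)%E.
Proof.
move=> s10 s20 Xd /andP[w0 w1].
have mpdf (m s : R) : measurable_fun [set: R] (normal_pdf m s).
  exact: measurable_normal_pdf.
have mabs (m s : R) :
    measurable_fun [set: R] (fun x => (`|x| * normal_pdf m s x)%:E).
  by apply/measurable_EFinP; apply: measurable_funM.
have abs_ge0 (m s x : R) : (0 <= (`|x| * normal_pdf m s x)%:E)%E.
  by rewrite lee_fin mulr_ge0// normal_pdf_ge0.
have momentE (m s : R) : 0 < s -> (normal_abs_moment m s)%:E =
    (\int[lebesgue_measure]_x (`|x| * normal_pdf m s x)%:E)%E.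
  move=> s0; rewrite /normal_abs_moment /Rintegral fineK//.
  rewrite ge0_fin_numE; first exact: normal_abs_moment_lty.
  by apply: integral_ge0 => x _.
have mmix : measurable_fun [set: R] (mixture_pdf m1 s1 m2 s2 w).
  by apply: measurable_funD; apply: measurable_funM.
pose X' : T -> measurableTypeR R := X.
have mX' : measurable_fun [set: T] X' by exact: (@measurable_funPT _ _ _ _ X).
pose X0 : {RV P >-> measurableTypeR R} := mfun_Sub (mem_set mX').
have mabsE : measurable_fun [set: measurableTypeR R] (fun y => (`|y|)%:E).
  exact/measurable_EFinP.
have <- := @ge0_integral_distribution _ _ _ _ _ P X0 _ mabsE
  (fun y => normr_ge0 y).
rewrite (@ge0_integral_density _ _ _ _ (@lebesgue_measure R)
  (mixture_pdf m1 s1 m2 s2 w))//.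
rewrite EFinD !momentE// -ge0_integralD//=.
apply: ge0_le_integral => //=.
- move=> x _; rewrite -EFinM lee_fin mulr_ge0// addr_ge0// mulr_ge0//;
    rewrite ?subr_ge0// normal_pdf_ge0//.
- by apply: emeasurable_funM; apply/measurable_EFinP.
- by apply: emeasurable_funD; exact: mabs.
- move=> x _; rewrite -EFinM -EFinD lee_fin -mulrDr ler_wpM2l//.
  have p1 := normal_pdf_ge0 m1 s1 x; have p2 := normal_pdf_ge0 m2 s2 x.
  rewrite /mixture_pdf lerD// ler_piMl//; lra.
- exact: mabs.
- exact: mabs.
Qed.

Lemma probability_preimageU {d} {T : measurableType d} {R : realType}
    (P : probability T R) (X Y : {RV P >-> R}) (A : set R) (a b : R) :
  independent_RV X Y -> measurable A ->
  P (X @^-1` A) = a%:E -> P (Y @^-1` A) = b%:E ->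
  P (X @^-1` A `|` Y @^-1` A) = (a + b - a * b)%:E.
Proof.
move=> XY mA Xa Yb.
have mX : measurable (X @^-1` A) by exact: measurable_funPTI.
have mY : measurable (Y @^-1` A) by exact: measurable_funPTI.
by rewrite measureUfinr//= ?XY// ?Yb ?ltry// Xa.
Qed.
(** The component functions are parameters because both the open and the closed half-line
    probabilities of the normal laws are plugged in. *)
Definition mixture_cdf {R : realType} (c1 c2 : R -> R) (w x : R) : R :=
  w * c1 x + (1 - w) * c2 x.

Lemma measurable_mixture_cdf {d} {T : measurableType d} {R : realType}
    (c1 c2 : R -> R) (w x : T -> R) :
  measurable_fun [set: R] c1 -> measurable_fun [set: R] c2 ->
  measurable_fun [set: T] w -> measurable_fun [set: T] x ->
  measurable_fun [set: T] (fun t => mixture_cdf c1 c2 (w t) (x t)).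
Proof.
move=> mc1 mc2 mw mx; apply: measurable_funD; apply: measurable_funM => //.
- exact: measurableT_comp.
- exact: measurable_funB.
- exact: measurableT_comp.
Qed.

Definition normal_cdf_open {R : realType} (m s x : R) : R :=
  fine (normal_prob m s `]-oo, x[).

Lemma measurable_normal_cdf_open {R : realType} (m s : R) :
  measurable_fun [set: R] (normal_cdf_open m s).
Proof.
apply: nondecreasing_measurable => // x y xy.
rewrite fine_le ?fin_num_measure// le_measure ?inE//.
by apply: subset_itvl; rewrite bnd_simp.
Qed.

(** * Minimum and maximum of the two mixture demands *)

Section fuzzy_demand.
Context {R : realType} (m1 s1 m2 s2 p1 p2 p3 p4 : R).
Hypotheses (s10 : 0 < s1) (s20 : 0 < s2).
Hypotheses (hp1 : 0 <= p1) (hp12 : p1 <= p2) (hp23 : p2 <= p3)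
  (hp34 : p3 <= p4) (hp4 : p4 <= 1).
Context {d} {T : measurableType d} (P : probability T R).
Variables X1 X2 : R -> {RV P >-> R}.
Hypothesis hindep : forall al : R, 0 <= al <= 1 ->
  independent_RV (X1 al) (X2 al).
Hypothesis hX1 : forall al : R, 0 <= al <= 1 ->
  has_density (X1 al) (mixture_pdf m1 s1 m2 s2 (trap_lower p1 p2 al)).
Hypothesis hX2 : forall al : R, 0 <= al <= 1 ->
  has_density (X2 al) (mixture_pdf m1 s1 m2 s2 (trap_upper p3 p4 al)).

Let Zmin (al : R) (t : T) : R := Num.min (X1 al t) (X2 al t).
Let Zmax (al : R) (t : T) : R := Num.max (X1 al t) (X2 al t).

(** Both extremes are at most [|X1| + |X2|] in absolute value, and each summand has mean at most the
    sum of the two normal moments. *)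
Let K : R := 2 * (normal_abs_moment m1 s1 + normal_abs_moment m2 s2).

Let lower_cdf (c1 c2 : R -> R) (al x : R) : R :=
  mixture_cdf c1 c2 (trap_lower p1 p2 al) x.
Let upper_cdf (c1 c2 : R -> R) (al x : R) : R :=
  mixture_cdf c1 c2 (trap_upper p3 p4 al) x.
Let max_cdf (c1 c2 : R -> R) (al x : R) : R :=
  lower_cdf c1 c2 al x * upper_cdf c1 c2 al x.
Let min_cdf (c1 c2 : R -> R) (al x : R) : R :=
  lower_cdf c1 c2 al x + upper_cdf c1 c2 al x - max_cdf c1 c2 al x.

Let lower01 (al : R) : 0 <= al <= 1 -> 0 <= trap_lower p1 p2 al <= 1.
Proof.
move: hp1 hp12 hp23 hp34 hp4 => h1 h2 h3 h4 h5 /andP[a0 a1].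
rewrite /trap_lower; apply/andP; split; nra.
Qed.

Let upper01 (al : R) : 0 <= al <= 1 -> 0 <= trap_upper p3 p4 al <= 1.
Proof.
move: hp1 hp12 hp23 hp34 hp4 => h1 h2 h3 h4 h5 /andP[a0 a1].
rewrite /trap_upper; apply/andP; split; nra.
Qed.

Let measurable_lower_cdf (c1 c2 : R -> R) :
  measurable_fun [set: R] c1 -> measurable_fun [set: R] c2 ->
  measurable_fun [set: R * R] (fun z => lower_cdf c1 c2 z.1 z.2).
Proof.
move=> mc1 mc2; apply: measurable_mixture_cdf => //.
by apply: measurable_funD => //; exact: measurable_funM.
Qed.

Let measurable_upper_cdf (c1 c2 : R -> R) :
  measurable_fun [set: R] c1 -> measurable_fun [set: R] c2 ->
  measurable_fun [set: R * R] (fun z => upper_cdf c1 c2 z.1 z.2).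
Proof.
move=> mc1 mc2; apply: measurable_mixture_cdf => //.
by apply: measurable_funD => //; exact: measurable_funM.
Qed.

Let measurable_max_cdf (c1 c2 : R -> R) :
  measurable_fun [set: R] c1 -> measurable_fun [set: R] c2 ->
  measurable_fun [set: R * R] (fun z => max_cdf c1 c2 z.1 z.2).
Proof.
move=> mc1 mc2; apply: measurable_funM.
  exact: measurable_lower_cdf.
exact: measurable_upper_cdf.
Qed.

Let measurable_min_cdf (c1 c2 : R -> R) :
  measurable_fun [set: R] c1 -> measurable_fun [set: R] c2 ->
  measurable_fun [set: R * R] (fun z => min_cdf c1 c2 z.1 z.2).
Proof.
move=> mc1 mc2; apply: measurable_funB; last exact: measurable_max_cdf.
apply: measurable_funD; first exact: measurable_lower_cdf.
exact: measurable_upper_cdf.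
Qed.

(** [b] selects the half-line: [true] is open, [false] is closed. The maximum lies in it when both
    demands do, so independence gives a product. *)
Let Zmax_prob (al x : R) (b : bool) : 0 <= al <= 1 ->
  P (Zmax al @^-1` [set` Interval -oo%O (BSide b x)]) =
  (max_cdf (fun x => fine (normal_prob m1 s1 [set` Interval -oo%O (BSide b x)]))
    (fun x => fine (normal_prob m2 s2 [set` Interval -oo%O (BSide b x)]))
    al x)%:E.
Proof.
move=> al01.
rewrite [X in P X](_ : _ = X1 al @^-1` [set` Interval -oo%O (BSide b x)] `&`
    X2 al @^-1` [set` Interval -oo%O (BSide b x)]); last first.
  apply/seteqP; split => t /=; rewrite /Zmax !in_itv/=; case: b => /=;
    rewrite ?gt_max ?ge_max; by [move/andP|move=> [-> ->]].
rewrite (hindep _ al01)//.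
by rewrite (has_density_mixture_prob _ _ _ _ _ _ _ _ (hX1 _ al01)) ?lower01//
  (has_density_mixture_prob _ _ _ _ _ _ _ _ (hX2 _ al01)) ?upper01.
Qed.

(** The minimum lies in the half-line when at least one demand does; inclusion-exclusion and
    independence give the formula. *)
Let Zmin_prob (al x : R) (b : bool) : 0 <= al <= 1 ->
  P (Zmin al @^-1` [set` Interval -oo%O (BSide b x)]) =
  (min_cdf (fun x => fine (normal_prob m1 s1 [set` Interval -oo%O (BSide b x)]))
    (fun x => fine (normal_prob m2 s2 [set` Interval -oo%O (BSide b x)]))
    al x)%:E.
Proof.
move=> al01.
rewrite [X in P X](_ : _ = X1 al @^-1` [set` Interval -oo%O (BSide b x)] `|`
    X2 al @^-1` [set` Interval -oo%O (BSide b x)]); last first.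
  apply/seteqP; split => t /=; rewrite /Zmin !in_itv/=; case: b => /=;
    rewrite ?gt_min ?ge_min; by [move/orP|move=> [->|->]; rewrite ?orbT].
apply: probability_preimageU => //; first exact: hindep.
- by apply: has_density_mixture_prob (hX1 _ al01) _ _; rewrite ?lower01.
- by apply: has_density_mixture_prob (hX2 _ al01) _ _; rewrite ?upper01.
Qed.

Let Zmax_measurable (al : R) :
  0 <= al <= 1 -> measurable_fun [set: T] (Zmax al).
Proof. by move=> _; exact: measurable_maxr. Qed.

Let Zmin_measurable (al : R) :
  0 <= al <= 1 -> measurable_fun [set: T] (Zmin al).
Proof. by move=> _; exact: measurable_minr. Qed.

Let moment_le (al : R) (Z : T -> R) : 0 <= al <= 1 ->
  measurable_fun [set: T] Z ->
  (forall t, `|Z t| <= `|X1 al t| + `|X2 al t|) ->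
  (\int[P]_t (`|Z t|)%:E <= K%:E)%E.
Proof.
move=> al01 mZ ZX.
apply: (@le_trans _ _ (\int[P]_t (`|X1 al t| + `|X2 al t|)%:E)%E).
  apply: ge0_le_integral => //=.
  - by apply/measurable_EFinP; exact: measurableT_comp.
  - by apply/measurable_EFinP; apply: measurable_funD; exact: measurableT_comp.
  - by move=> t _; rewrite lee_fin.
under eq_integral do rewrite EFinD.
rewrite ge0_integralD//=; [|exact/measurable_EFinP/measurableT_comp..].
rewrite /K mulr_natl mulr2n EFinD leeD//.
  exact: (has_density_mixture_abs_moment _ _ _ _ _ _ _ s10 s20
    (hX1 _ al01) (lower01 _ al01)).
exact: (has_density_mixture_abs_moment _ _ _ _ _ _ _ s10 s20
  (hX2 _ al01) (upper01 _ al01)).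
Qed.

Let Zmax_moment (al : R) : 0 <= al <= 1 ->
  (\int[P]_t (`|Zmax al t|)%:E <= K%:E)%E.
Proof.
move=> al01; apply: (moment_le _ _ al01); first exact: Zmax_measurable.
by move=> t; rewrite /Zmax; case: (leP (X1 al t)) => _; rewrite ?lerDl ?lerDr.
Qed.

Let Zmin_moment (al : R) : 0 <= al <= 1 ->
  (\int[P]_t (`|Zmin al t|)%:E <= K%:E)%E.
Proof.
move=> al01; apply: (moment_le _ _ al01); first exact: Zmin_measurable.
by move=> t; rewrite /Zmin; case: (leP (X1 al t)) => _; rewrite ?lerDl ?lerDr.
Qed.

Let F1 := normal_cdf m1 s1.
Let F2 := normal_cdf m2 s2.

(** Each factor is [F2 + w * (F1 - F2)] with [w] affine in alpha, so the product is quadratic in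
    alpha and its integral is explicit. *)
Let max_cdfE (x al : R) : max_cdf F1 F2 al x =
  (F2 x + p1 * (F1 x - F2 x)) * (F2 x + p4 * (F1 x - F2 x))
  + ((F2 x + p1 * (F1 x - F2 x)) * ((p3 - p4) * (F1 x - F2 x))
     + (p2 - p1) * (F1 x - F2 x) * (F2 x + p4 * (F1 x - F2 x))) * al
  + (p2 - p1) * (F1 x - F2 x) * ((p3 - p4) * (F1 x - F2 x)) * al ^+ 2.
Proof.
rewrite /max_cdf /lower_cdf /upper_cdf /mixture_cdf /trap_lower /trap_upper.
by move: (F1 x) (F2 x) => a b; ring.
Qed.

Let min_cdfE (x al : R) : min_cdf F1 F2 al x =
  (F2 x + p1 * (F1 x - F2 x)) + (F2 x + p4 * (F1 x - F2 x))
    - (F2 x + p1 * (F1 x - F2 x)) * (F2 x + p4 * (F1 x - F2 x))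
  + ((p2 - p1) * (F1 x - F2 x) + (p3 - p4) * (F1 x - F2 x)
     - ((F2 x + p1 * (F1 x - F2 x)) * ((p3 - p4) * (F1 x - F2 x))
     + (p2 - p1) * (F1 x - F2 x) * (F2 x + p4 * (F1 x - F2 x)))) * al
  + (- ((p2 - p1) * (F1 x - F2 x) * ((p3 - p4) * (F1 x - F2 x)))) * al ^+ 2.
Proof.
rewrite /min_cdf max_cdfE /lower_cdf /upper_cdf /mixture_cdf.
rewrite /trap_lower /trap_upper.
by move: (F1 x) (F2 x) => a b; ring.
Qed.

Let max_cdf_integrable (x : R) :
  (@lebesgue_measure R).-integrable `[0, 1] (EFin \o (max_cdf F1 F2)^~ x).
Proof.
apply: eq_integrable (quadratic_integrable _ _ _) => //.
by move=> al _; rewrite /= max_cdfE.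
Qed.

Let min_cdf_integrable (x : R) :
  (@lebesgue_measure R).-integrable `[0, 1] (EFin \o (min_cdf F1 F2)^~ x).
Proof.
apply: eq_integrable (quadratic_integrable _ _ _) => //.
by move=> al _; rewrite /= min_cdfE.
Qed.

Let Rintegral_max_cdf (x : R) :
  \int[lebesgue_measure]_(al in `[0, 1]) max_cdf F1 F2 al x =
  fuzzyH m1 s1 m2 s2 p1 p2 p3 p4 x / 2.
Proof.
etransitivity; first by apply: eq_Rintegral => al _; exact: max_cdfE.
rewrite Rintegral_quadratic /fuzzyH /P1 /P2 /P3 -/(F1 x) -/(F2 x).
by move: (F1 x) (F2 x) => a b; field.
Qed.

(** [J] averages the sum of the two mixture distribution functions and [H / 2] their product. *)
Let Rintegral_min_cdf (x : R) :
  \int[lebesgue_measure]_(al in `[0, 1]) min_cdf F1 F2 al x =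
  fuzzyJ m1 s1 m2 s2 p1 p2 p3 p4 x - fuzzyH m1 s1 m2 s2 p1 p2 p3 p4 x / 2.
Proof.
etransitivity; first by apply: eq_Rintegral => al _; exact: min_cdfE.
rewrite Rintegral_quadratic /fuzzyJ /fuzzyH /P1 /P2 /P3 -/(F1 x) -/(F2 x).
by move: (F1 x) (F2 x) => a b; field.
Qed.

(** * Supergradients of the expected fuzzy profit *)

Variables (M C V : R).
Hypotheses (hVC : V < C) (hCM : C < M).

Lemma expected_lowerE (Q : R) : expected_lower X1 X2 M C V Q =
  ((M - C) * Q - (M - V) * mean_shortage P Zmin Q)%:E.
Proof.
rewrite -(expected_newsvendor_profit P _ _ _ Zmin_measurable Zmin_moment
  (fun al x => Zmin_prob al x true)
  (measurable_min_cdf _ _ (measurable_normal_cdf_open m1 s1)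
    (measurable_normal_cdf_open m2 s2))).
rewrite /expected_lower; apply: eq_integral => al _.
by congr expectation; apply/funext => t; rewrite profit_lowerE.
Qed.

Lemma expected_upperE (Q : R) : expected_upper X1 X2 M C V Q =
  ((M - C) * Q - (M - V) * mean_shortage P Zmax Q)%:E.
Proof.
rewrite -(expected_newsvendor_profit P _ _ _ Zmax_measurable Zmax_moment
  (fun al x => Zmax_prob al x true)
  (measurable_max_cdf _ _ (measurable_normal_cdf_open m1 s1)
    (measurable_normal_cdf_open m2 s2))).
rewrite /expected_upper; apply: eq_integral => al _.
by congr expectation; apply/funext => t; rewrite profit_upperE.
Qed.

Lemma expected_profit_supergradient (beta Q Q' : R) : 0 <= beta <= 1 ->
  expected_profit X1 X2 M C V beta Q' - expected_profit X1 X2 M C V beta Q <=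
  (Q' - Q) *
    ((M - C) - (M - V) * fuzzyF m1 s1 m2 s2 p1 p2 p3 p4 beta Q).
Proof.
move=> /andP[b0 b1]; rewrite /expected_profit !expected_lowerE !expected_upperE.
have hmin := mean_shortage_subgradient P _ _ _ _ Zmin_measurable Zmin_moment
  (fun al x => Zmin_prob al x true)
  (measurable_min_cdf _ _ (measurable_normal_cdf_open m1 s1)
    (measurable_normal_cdf_open m2 s2))
  (fun al x => Zmin_prob al x false) min_cdf_integrable Q Q'.
have hmax := mean_shortage_subgradient P _ _ _ _ Zmax_measurable Zmax_moment
  (fun al x => Zmax_prob al x true)
  (measurable_max_cdf _ _ (measurable_normal_cdf_open m1 s1)
    (measurable_normal_cdf_open m2 s2))
  (fun al x => Zmax_prob al x false) max_cdf_integrable Q Q'.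
move: hmin hmax; rewrite Rintegral_min_cdf Rintegral_max_cdf /fuzzyF.
move: (fuzzyH _ _ _ _ _ _ _ _ _) (fuzzyJ _ _ _ _ _ _ _ _ _) => H J.
move: (mean_shortage P Zmin Q') (mean_shortage P Zmin Q) => n' n.
move: (mean_shortage P Zmax Q') (mean_shortage P Zmax Q) => x' x hmin hmax /=.
have A0 : 0 <= M - V by rewrite subr_ge0 ltW// (lt_trans hVC).
have b1' : 0 <= 1 - beta by rewrite subr_ge0.
(* The shortages enter the profit with factor [-(M - V)], which turns their subgradients into a
   supergradient. *)
have := ler_wpM2l (mulr_ge0 A0 b1') hmin.
have := ler_wpM2l (mulr_ge0 A0 b0) hmax.
lra.
Qed.

End fuzzy_demand.

Theorem mainTheorem1 (R : realType)
  (V C M : R) (hVC : V < C) (hCM : C < M)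
  (mu1 sigma1 mu2 sigma2 : R) (hsigma1 : 0 < sigma1) (hsigma2 : 0 < sigma2)
  (p1 p2 p3 p4 : R)
  (hp1 : 0 <= p1) (hp12 : p1 <= p2) (hp23 : p2 <= p3) (hp34 : p3 <= p4)
  (hp4 : p4 <= 1)
  (beta : R) (hbeta : 0 <= beta <= 1)
  (d : measure_display) (T : measurableType d) (P : probability T R)
  (X1 X2 : R -> {RV P >-> R})
  (hindep : forall alpha : R, 0 <= alpha <= 1 ->
     independent_RV (X1 alpha) (X2 alpha))
  (hX1 : forall alpha : R, 0 <= alpha <= 1 ->
     has_density (X1 alpha)
       (mixture_pdf mu1 sigma1 mu2 sigma2 (trap_lower p1 p2 alpha)))
  (hX2 : forall alpha : R, 0 <= alpha <= 1 ->
     has_density (X2 alpha)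
       (mixture_pdf mu1 sigma1 mu2 sigma2 (trap_upper p3 p4 alpha))) :
  let F := fuzzyF mu1 sigma1 mu2 sigma2 p1 p2 p3 p4 beta in
  let G := expected_profit X1 X2 M C V beta in
  let Qstar := pinv [set: R] F ((M - C) / (M - V)) in
  [/\ (forall Q : R, expected_lower X1 X2 M C V Q \is a fin_num /\
                     expected_upper X1 X2 M C V Q \is a fin_num),
      concave_function [set: R] G,
      set_bij [set: R] `]0, 1[ F &
      forall Q : R, G Q <= G Qstar ?= iff (Q == Qstar)].
Proof.
move=> F G Qstar.
have s10 : sigma1 != 0 by rewrite gt_eqF.
have s20 : sigma2 != 0 by rewrite gt_eqF.
have A0 : 0 < M - V by rewrite subr_gt0 (lt_trans hVC).
have Fbij : set_bij [set: R] `]0, 1[ F by exact: fuzzyF_bij.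
have F_inj : injective F.
  by move=> x y; case: Fbij => _ + _; apply; rewrite inE.
have FQstar : F Qstar = (M - C) / (M - V).
  (* [pinv] inverts F only on its image; [V < C < M] places the critical ratio in []0, 1[]. *)
  apply: pinvK; rewrite inE; case: Fbij => _ _; apply.
  rewrite /= in_itv/=; apply/andP; split; first by rewrite divr_gt0// subr_gt0.
  by rewrite ltr_pdivrMr// mul1r ltrD2l ltrN2.
have supergradient (Q Q' : R) :
    G Q' - G Q <= (Q' - Q) * ((M - C) - (M - V) * F Q).
  exact: expected_profit_supergradient.
split=> //.
- move=> Q.
  rewrite (expected_lowerE _ _ _ _ _ _ _ _ hsigma1 hsigma2 hp1 hp12 hp23 hp34
    hp4 P X1 X2 hindep hX1 hX2)//.
  by rewrite (expected_upperE _ _ _ _ _ _ _ _ hsigma1 hsigma2 hp1 hp12 hp23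
    hp34 hp4 P X1 X2 hindep hX1 hX2).
- exact: supergradient_concave supergradient.
- move=> Q; apply: supergradient_unique_max supergradient _ _ Q.
    move=> x y /addrI/oppr_inj/mulfI; rewrite gt_eqF// => /(_ isT).
    exact: F_inj.
  by rewrite FQstar mulrCA divff ?gt_eqF// mulr1 subrr.
Qed.
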